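(* Let $\mathrm S$ (system) and $\mathrm E$ (environment) be finite-dimensional quantum systems of dimensions $d_{\mathrm S},d_{\mathrm E}$ with $d=d_{\mathrm S}d_{\mathrm E}\ge 2$, let $\rho_{\mathrm S},\rho_{\mathrm E}$ be states of $\mathrm S$ and $\mathrm E$, let $\mathcal U$ be a unital quantum channel on the joint system, and put $\rho'_{\mathrm{SE}}=\mathcal U(\rho_{\mathrm S}\otimes\rho_{\mathrm E})$, $\rho'_{\mathrm S}=\mathrm{Tr}_{\mathrm E}\,\rho'_{\mathrm{SE}}$, $\rho'_{\mathrm E}=\mathrm{Tr}_{\mathrm S}\,\rho'_{\mathrm{SE}}$. Write $\Delta S_X=S(\rho'_X)-S(\rho_X)$ and $\Delta C_X=C(\rho'_X)-C(\rho_X)$ for $X\in\{\mathrm S,\mathrm E\}$, and let $I_{\mathrm{SE}}=S(\rho'_{\mathrm{SE}}\|\rho'_{\mathrm S}\otimes\rho'_{\mathrm E})$ be the mutual information of $\rho'_{\mathrm{SE}}$. Then $$\Delta S_{\mathrm S}+\Delta S_{\mathrm E}\ \ge\ \big(S(\rho_{\mathrm S})+S(\rho_{\mathrm E})+1\big)\left\{\left[1+\frac{-\Delta C_{\mathrm S}-\Delta C_{\mathrm E}-\kappa\,f(I_{\mathrm{SE}}/\ln 2)}{\big(S(\rho_{\mathrm S})+S(\rho_{\mathrm E})+1\big)^2}\right]^{1/2}-1\right\},$$ where $\kappa=\sqrt{2\ln 2}\,\big(12\ln^2 2+9\ln^2 d\big)$ and $f(x)=\max\{x^{1/4},x^{1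/2}\}$.
   Context: $S(\rho)=-\mathrm{Tr}(\rho\ln\rho)$ is the von Neumann entropy, $C(\rho)=\mathrm{Tr}[\rho(\ln\rho)^2]-S(\rho)^2$ is the variance of $-\ln\rho$, and $S(\rho\|\sigma)=\mathrm{Tr}[\rho(\ln\rho-\ln\sigma)]$ is the relative entropy. A quantum channel (completely positive trace-preserving map) $\mathcal U$ is unital if $\mathcal U(\mathbb 1)=\mathbb 1$. The bound is non-trivial only when the numerator of the fraction in square brackets is positive, i.e. when the total decrease of the variances is sufficiently large. *)

(* Defs.v *)
From mathcomp Require Import all_boot all_order all_algebra.
From mathcomp Require Import complex mxtens.
From mathcomp Require Import all_classical all_reals all_analysis.

Set Implicit Arguments.
Unset Strict Implicit.
Unset Printing Implicit Defensive.

Import Order.TTheory GRing.Theory Num.Theory.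
Local Open Scope ring_scope.

(* A system of dimension n is 'M[R[i]]_n.  The composite of systems of dimensions
   m and n is 'M[R[i]]_(m * n), with basis vectors mxtens_index (i, k), matching
   the Kronecker product tensmx. *)
Section States.
Variable R : realType.
Notation C := R[i].

(* In the order of R[i], 0 <= z says that z is real and nonnegative; the
   condition therefore forces A to be Hermitian. *)
Definition psdmx n (A : 'M[C]_n) : Prop :=
  forall v : 'cV[C]_n, 0 <= ((map_mx Num.conj v)^T *m A *m v) 0 0.

Definition state n (rho : 'M[C]_n) : Prop := psdmx rho /\ \tr rho = 1.

Definition ptrace_l m n (A : 'M[C]_(m * n)) : 'M[C]_n :=
  \matrix_(k, l) \sum_i A (mxtens_index (i, k)) (mxtens_index (i, l)).

Definition ptrace_r m n (A : 'M[C]_(m * n)) : 'M[C]_m :=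
  \matrix_(i, j) \sum_k A (mxtens_index (i, k)) (mxtens_index (j, k)).

(* id_k (x) Phi: apply Phi to each of the k x k blocks (of size n) of A. *)
Definition ampliation k m n (Phi : 'M[C]_n -> 'M[C]_m) (A : 'M[C]_(k * n)) :
    'M[C]_(k * m) :=
  \matrix_(p, q)
    let: (i, a) := mxtens_unindex p in
    let: (j, b) := mxtens_unindex q in
    Phi (\matrix_(c, e) A (mxtens_index (i, c)) (mxtens_index (j, e))) a b.

Definition completely_positive m n (Phi : 'M[C]_n -> 'M[C]_m) : Prop :=
  forall k (A : 'M[C]_(k * n)), psdmx A -> psdmx (ampliation Phi A).

Definition channel m n (Phi : {linear 'M[C]_n -> 'M[C]_m}) : Prop :=
  completely_positive Phi /\ forall A, \tr (Phi A) = \tr A.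

Definition unital n (Phi : {linear 'M[C]_n -> 'M[C]_n}) : Prop :=
  Phi 1%:M = 1%:M.

(* Logarithm of a positive semidefinite matrix by spectral calculus.  Since
   ln 0 = 0 for the real logarithm used here, mxln is zero on the kernel of A,
   which gives the usual conventions 0 ln 0 = 0 and 0 (ln 0)^2 = 0 below. *)
Definition mxln n (A : 'M[C]_n) : 'M[C]_n :=
  invmx (spectralmx A)
  *m diag_mx (map_mx (fun z : C => (ln (complex.Re z))%:C%C) (spectral_diag A))
  *m spectralmx A.

(* The traces below are real on states; complex.Re only changes the type. *)
Definition entropy n (rho : 'M[C]_n) : R :=
  - complex.Re (\tr (rho *m mxln rho)).

Definition entropy_variance n (rho : 'M[C]_n) : R :=
  complex.Re (\tr (rho *m (mxln rho *m mxln rho))) - entropy rho ^+ 2.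

(* This is the relative entropy when the kernel of sigma is contained in that of
   rho; otherwise the relative entropy is +oo.  The containment always holds
   between a bipartite state and the product of its marginals. *)
Definition relative_entropy n (rho sigma : 'M[C]_n) : R :=
  complex.Re (\tr (rho *m (mxln rho - mxln sigma))).

Definition mutual_information m n (rho : 'M[C]_(m * n)) : R :=
  relative_entropy rho (tensmx (ptrace_r rho) (ptrace_l rho)).

Definition kappa (d : nat) : R :=
  Num.sqrt (2 * ln 2) * (12 * ln 2 ^+ 2 + 9 * ln d%:R ^+ 2).

Definition f_corr (x : R) : R := Num.max (x `^ (1 / 4)) (x `^ (1 / 2)).

End States.

(* Main.v *)
(* Let t, q and w be the spectra of rho_S (x) rho_E, of rho_S' (x) rho_E' and of
   rho_SE' = U(rho_S (x) rho_E), and let r be the diagonal of rho_SE' in the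
   product eigenbasis of rho_S' (x) rho_E'.  Since U is positive, unital and trace
   preserving, r = B t with B doubly stochastic.  The function
   g(x) = x (1 - ln x)^2 is concave on [0, 1] with g' = ln^2 - 1, and for a
   state the sum of g over the spectrum is C + (S + 1)^2; hence
     sum g(t) <= sum g(q) + X,   X = sum (r - q) ln^2 q.
   As r and q have the same marginals, only the cross term of
   ln^2 q = (ln q_S + ln q_E)^2 contributes to X, and constants may be added to
   ln q_S and ln q_E.  Finally I_SE = sum w ln w - sum r ln q, where r = a w with a
   doubly stochastic; Klein's inequality with its Hellinger remainder and
   Cauchy-Schwarz bound X^2 by a constant times I_SE, which is better than
   (kappa f(I_SE / ln 2))^2. *)
Require Import Defs.
From mathcomp Require Import all_boot all_order all_algebra.
From mathcomp Require Import complex mxtens.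
From mathcomp Require Import all_classical all_reals all_analysis.
From mathcomp Require Import ring lra.

Set Implicit Arguments.
Unset Strict Implicit.
Unset Printing Implicit Defensive.

Import Order.TTheory GRing.Theory Num.Theory.
Import numFieldNormedType.Exports.
Local Open Scope ring_scope.

(** * Scalar inequalities for the logarithm and the exponential *)

Section Scalar.
Variable R : realType.
Implicit Types (x y t q w : R).

Lemma ge0_of_derive (f df : R -> R) :
  (forall x, is_derive x 1 f (df x)) -> (forall x, 0 < x -> 0 <= df x) ->
  f 0 = 0 -> forall x, 0 <= x -> 0 <= f x.
Proof.
move=> fdf df0 f0 x; rewrite le_eqVlt => /predU1P[<-|x0]; first by rewrite f0.
have cf : ({within `[0, x], continuous f})%classic.
  by apply: derivable_within_continuous => y _; case: (fdf y).
have [c /[!in_itv]/= /andP[c0 _]] := MVT x0 (fun y _ => fdf y) cf.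
rewrite f0 !subr0 => ->.
by rewrite mulr_ge0 ?df0 ?ltW.
Qed.

Lemma expR_quad_lower x : 0 <= x -> 1 + x + x ^+ 2 / 2 <= expR x.
Proof.
move=> x0; rewrite -subr_ge0.
apply: (@ge0_of_derive (fun y => expR y - (1 + y + y ^+ 2 / 2))
  (fun y => expR y - (1 + y))) => // [y|y _|].
- apply: is_derive_eq.
  by rewrite /GRing.scale /=; field.
- by rewrite subr_ge0 expR_ge1Dx.
- by rewrite expR0 expr0n /= mul0r !addr0 subrr.
Qed.

(** This is [tangent_ineq] at the endpoint [t = 1] with [q = expR (- x)]. *)
Lemma expRN_quad_lower x : 0 <= x -> 2 - x ^+ 2 <= (2 + 2 * x) * expR (- x).
Proof.
move=> x0; rewrite -subr_ge0.
apply: (@ge0_of_derive (fun y => (2 + 2 * y) * expR (- y) - (2 - y ^+ 2))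
  (fun y => 2 * y * (1 - expR (- y)))) => // [y|y y0|].
- apply: is_derive_eq.
  by rewrite /GRing.scale /=; ring.
- by rewrite !mulr_ge0 ?(ltW y0)// subr_ge0 expR_le1 oppr_le0 ltW.
- by rewrite oppr0 expR0 expr0n /= mulr0 addr0 subr0 mulr1 subrr.
Qed.


(* With [t / q = expR d], this compares [expR d - 1 - d] with
   [d ^+ 2 / (2 * (1 - ln q))]; the case [d < 0] uses [- ln q >= - d]. *)
Lemma tangent_ineq t q : 0 <= t <= 1 -> 0 < q <= 1 ->
  t * (1 - ln t) ^+ 2 <=
  q * (1 - ln q) ^+ 2 + (ln q ^+ 2 - 1) * (t - q).
Proof.
move=> /andP[]; rewrite le_eqVlt => /predU1P[<- _ /andP[q0 q1]|t0 t1 /andP[q0 q1]].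
  have b0 := ln_le0 q1; rewrite mul0r sub0r.
  have -> : q * (1 - ln q) ^+ 2 + (ln q ^+ 2 - 1) * - q =
    2 * (q * (1 - ln q)) by ring.
  by rewrite !mulr_ge0 ?(ltW q0)//; lra.
have a0 := ln_le0 t1; have b0 := ln_le0 q1.
rewrite -{1 3}(lnK t0) -{1 4}(lnK q0).
set a := ln t in a0 *; set b := ln q in b0 *.
have -> : expR b = expR a * expR (b - a) by rewrite -expRD; congr expR; ring.
have ea := expR_gt0 a.
(* The claim divided by [expR a = t]. *)
suff : 2 - 2 * a + a ^+ 2 - b ^+ 2 <= 2 * (1 - b) * expR (b - a) by nra.
have [ba|ab] := leP 0 (b - a).
  have := expR_quad_lower ba; set e := expR _ => h.
  have : 2 * (1 - b) * (1 + (b - a) + (b - a) ^+ 2 / 2) <= 2 * (1 - b) * e.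
    by apply: ler_wpM2l => //; lra.
  have : 0 <= - b * (b - a) ^+ 2 by rewrite mulr_ge0 ?sqr_ge0 ?oppr_ge0.
  lra.
(* With [x = a - b] and [e = expR (- x)], the gap is the gap of [expRN_quad_lower] plus
   [2 * (- a) * (e - (1 - x))], and [a <= 0]. *)
have x0 : 0 <= a - b by lra.
have := expRN_quad_lower x0; rewrite opprB; set e := expR _ => h.
have e0 : 0 < e by apply: expR_gt0.
have e1 : e <= 1 by rewrite expR_le1; lra.
have h1 := expR_ge1Dx (b - a); rewrite -/e in h1.
have : 0 <= - a * (e - (1 + (b - a))) by rewrite mulr_ge0 ?oppr_ge0 ?subr_ge0.
rewrite -/e; lra.
Qed.

(** With [x], [y] the square roots of [w], [q], the bound [ln (y / x) <= y / x - 1] gives [w * (ln w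
    - ln q) = 2 * x ^ 2 * (ln x - ln y) >= 2 * x * (x - y)], and the last term is
    [(x - y) ^ 2 + x ^ 2 - y ^ 2]. *)
Lemma relent_term_ge w q : 0 <= w -> 0 < q ->
  (Num.sqrt w - Num.sqrt q) ^+ 2 + w - q <= w * (ln w - ln q).
Proof.
rewrite le_eqVlt => /predU1P[<- q0|w0 q0].
  by rewrite sqrtr0 sub0r sqrrN sqr_sqrtr ?(ltW q0)// mul0r addr0 subrr.
set x := Num.sqrt w; set y := Num.sqrt q.
have x0 : 0 < x by rewrite sqrtr_gt0.
have y0 : 0 < y by rewrite sqrtr_gt0.
have -> : w = x ^+ 2 by rewrite sqr_sqrtr ?ltW.
have -> : q = y ^+ 2 by rewrite sqr_sqrtr ?ltW.
rewrite !lnXn//.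
have : ln (y / x) <= y / x - 1.
  have -> : y / x = 1 + (y / x - 1) by ring.
  rewrite [X in _ <= X - 1]addrC addrK.
  by apply: le_ln1Dx; rewrite ltrBDr addNr divr_gt0.
rewrite ln_div ?posrE// => h.
have : x * (ln y - ln x) <= y - x.
  have -> : y - x = x * (y / x - 1) by field; rewrite gt_eqF.
  by rewrite ler_pM2l.
nra.
Qed.

Lemma expR_quartic_upper x : 0 <= x -> x ^+ 4 <= 8 * expR x.
Proof.
move=> x0.
have e0 : 0 <= expR (x / 4) by exact: expR_ge0.
have -> : expR x = expR (x / 4) ^+ 4 by rewrite -expRM_natr; congr expR; field.
(* The function [x ^ 4 * expR (- x)] peaks at [x = 4], so the exponential is expanded there: [z = 1]
   at [x = 4], and [z ^ 4 >= 4 * z - 3]. The constant [61 / 100] lies just below [(5 / 4) ^ 4 / 4],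
   and its fourth power exceeds [1 / 8]. *)
have h : x * (61 / 100) <= expR (x / 4).
  have := expR_ge1Dx (1 / 4 : R); have := expR_ge1Dx (x / 16 - 1 / 4).
  have -> : x / 4 = (1 / 4 + (x / 16 - 1 / 4)) * 4 by field.
  rewrite (expRM_natr 4) (expRD (1 / 4)).
  set v := expR (x / 16 - _); set u := expR _ => hv hu.
  set z := x / 16 + 3 / 4.
  have : (5 / 4 * z) ^+ 4 <= (u * v) ^+ 4.
    apply: lerXn2r; rewrite ?nnegrE; first by rewrite /z; lra.
      by rewrite mulr_ge0 ?expR_ge0.
    by apply: ler_pM; rewrite /z; lra.
  apply: le_trans.
  have : 3 / 4 <= z by rewrite /z; lra.
  have := sqr_ge0 (z ^+ 2 - 1); have := sqr_ge0 (z - 1).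
  have -> : x = 16 * z - 12 by rewrite /z; field.
  move: z => z h1 h2 h3; nra.
have : (x * (61 / 100)) ^+ 4 <= expR (x / 4) ^+ 4.
  by apply: lerXn2r; rewrite ?nnegrE //; lra.
have : 0 <= x ^+ 4 by rewrite exprn_ge0.
lra.
Qed.

Lemma ln2_lower : 31 / 50 <= ln (2 : R).
Proof.
rewrite -ler_expR lnK ?posrE//.
(* A quarter of the exponent is small enough for the tangent bound, as
   [(169 / 200) ^ 4 >= 1 / 2]. *)
have : 169 / 200 <= expR (- (31 / 200) : R).
  by have := expR_ge1Dx (- (31 / 200) : R); lra.
have -> : expR (31 / 50 : R) = (expR (- (31 / 200)) ^+ 4)^-1.
  by rewrite -expRM_natr -expRN; congr expR; field.
set e := expR _ => he.
have : (169 / 200 : R) ^+ 4 <= e ^+ 4 by rewrite lerXn2r ?nnegrE; lra.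
move=> h; rewrite -[X in _ <= X]invrK lef_pV2 ?posrE ?invr_gt0//.
  by apply: le_trans h; rewrite !exprS expr0; lra.
by rewrite exprn_gt0//; lra.
Qed.

End Scalar.

(** * Doubly stochastic mixing and relative entropy of finite distributions *)

Section Sums.
Variable R : realType.

Lemma weighted_cauchy_schwarz (I : finType) (c x y : I -> R) :
  (forall i, 0 <= c i) ->
  (\sum_i c i * (x i * y i)) ^+ 2 <=
  (\sum_i c i * x i ^+ 2) * (\sum_i c i * y i ^+ 2).
Proof.
move=> c0; set X := \sum_i _; set H := \sum_i _; set M := \sum_i _.
have H0 : 0 <= H by apply: sumr_ge0 => i _; rewrite mulr_ge0 ?sqr_ge0.
(* The discriminant argument multiplied through by [H]; if [H = 0], every term of [X] vanishes. *)
have E : \sum_i c i * (H * y i - X * x i) ^+ 2 = H * (H * M - X ^+ 2).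
  transitivity (\sum_i (H ^+ 2 * (c i * y i ^+ 2) -
      2 * H * X * (c i * (x i * y i)) + X ^+ 2 * (c i * x i ^+ 2))).
    by apply: eq_bigr => i _; ring.
  by rewrite big_split sumrB /= -!mulr_sumr -/X -/H -/M; ring.
have : 0 <= H * (H * M - X ^+ 2).
  by rewrite -E; apply: sumr_ge0 => i _; rewrite mulr_ge0 ?sqr_ge0.
move: H0; rewrite le_eqVlt => /predU1P[H0 _|H0]; last first.
  by rewrite pmulr_rge0// subr_ge0.
suff -> : X = 0 by rewrite expr0n /= -H0 mul0r.
apply: big1 => i _.
have : c i * x i ^+ 2 == 0.
  have /psumr_eq0P : H = 0 by [].
  by move=> -> // k _; rewrite mulr_ge0 ?sqr_ge0.
by rewrite mulf_eq0 expf_eq0 /= => /orP[/eqP->|/eqP->]; rewrite !(mul0r,mulr0).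
Qed.

Lemma mixture_addr (K : finType) (b u : K -> R) (x : R) :
  \sum_k b k = 1 -> \sum_k b k * (u k + x) = \sum_k b k * u k + x.
Proof.
move=> b1; under eq_bigr => k _ do rewrite mulrDr.
by rewrite big_split /= -mulr_suml b1 mul1r.
Qed.

(** Rows and columns have separate index types because product eigenbases are indexed by pairs and
    joint spectra by ['I_(m * n)]. *)
Definition doubly_stochastic (P K : finType) (B : P -> K -> R) : Prop :=
  [/\ forall p k, 0 <= B p k,
      forall p, \sum_k B p k = 1 &
      forall k, \sum_p B p k = 1].

(* A null entry [q p] has a null mixture, so the terms with [q p = 0], where the
   tangent inequality is unavailable, vanish. *)
Lemma mixture_entropy_moment_le (P K : finType) (B : P -> K -> R)
    (q r : P -> R) (t : K -> R) :
  doubly_stochastic B ->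
  (forall p, 0 <= q p <= 1) -> (forall k, 0 <= t k <= 1) ->
  (forall p, r p = \sum_k B p k * t k) -> (forall p, q p = 0 -> r p = 0) ->
  \sum_p q p = \sum_p r p ->
  \sum_k t k * (1 - ln (t k)) ^+ 2 <=
  \sum_p q p * (1 - ln (q p)) ^+ 2 + \sum_p (r p - q p) * ln (q p) ^+ 2.
Proof.
move=> [B0 B1 B2] q01 t01 rE qr qs.
pose g x := x * (1 - @ln R x) ^+ 2.
have -> : \sum_k t k * (1 - ln (t k)) ^+ 2 = \sum_p \sum_k B p k * g (t k).
  rewrite exchange_big; apply: eq_bigr => k _.
  by rewrite -mulr_suml B2 mul1r.
(* The [- 1] in the slope [ln ^ 2 - 1] cancels because [q] and [r] have the same sum. What remains
   is the right-hand side of [tangent_ineq], averaged with the weights [B p k]. *)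
have -> : \sum_p q p * (1 - ln (q p)) ^+ 2 + \sum_p (r p - q p) * ln (q p) ^+ 2 =
    \sum_p \sum_k B p k * (g (q p) + (ln (q p) ^+ 2 - 1) * (t k - q p)).
  transitivity (\sum_p (g (q p) + (ln (q p) ^+ 2 - 1) * (r p - q p))).
    rewrite big_split /=; congr (_ + _).
    transitivity (\sum_p ((r p - q p) * ln (q p) ^+ 2 - (r p - q p))).
      by rewrite sumrB [X in _ - X]sumrB qs subrr subr0.
    by apply: eq_bigr => p _; ring.
  apply: eq_bigr => p _; set c := ln (q p) ^+ 2 - 1.
  transitivity (\sum_k B p k * (c * t k + (g (q p) - c * q p))).
    rewrite mixture_addr//.
    have -> : \sum_k B p k * (c * t k) = c * r p.
      by rewrite rE mulr_sumr; apply: eq_bigr => k _; ring.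
    by ring.
  by apply: eq_bigr => k _; ring.
apply: ler_sum => p _; apply: ler_sum => k _.
have /andP[] := q01 p; rewrite le_eqVlt => /predU1P[q0 _|q0 q1]; last first.
  by rewrite ler_wpM2l// tangent_ineq// q0.
have : B p k * t k = 0.
  move: (qr _ (esym q0)); rewrite rE => /psumr_eq0P -> // j _.
  by rewrite mulr_ge0//; case/andP: (t01 j).
move=> /eqP; rewrite mulf_eq0 => /orP[/eqP->|/eqP->]; first by rewrite !mul0r.
by rewrite -q0 subrr mulr0 addr0.
Qed.

(* Klein's inequality with the Hellinger remainder
   [\sum a p l * (sqrt (w l) - sqrt (q p)) ^+ 2], then Cauchy-Schwarz on
   [w - q = (sqrt w - sqrt q) * (sqrt w + sqrt q)]. *)
Lemma relent_bounds_sqr_difference (P L : finType) (a : P -> L -> R)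
    (q r : P -> R) (w : L -> R) (phi : P -> R) :
  let D := \sum_l w l * ln (w l) - \sum_p r p * ln (q p) in
  doubly_stochastic a ->
  (forall p, 0 <= q p) -> (forall l, 0 <= w l) ->
  (forall p, r p = \sum_l a p l * w l) -> (forall p, q p = 0 -> r p = 0) ->
  \sum_p q p = \sum_p r p ->
  0 <= D /\
  (\sum_p (r p - q p) * phi p) ^+ 2 <=
  2 * D * \sum_p (r p + q p) * phi p ^+ 2.
Proof.
move=> D [a0 a1 a2] q0 w0 rE qr qs.
pose s l := Num.sqrt (w l); pose z p := Num.sqrt (q p).
have s2 l : s l ^+ 2 = w l by rewrite sqr_sqrtr.
have z2 p : z p ^+ 2 = q p by rewrite sqr_sqrtr.
pose H := \sum_(i : P * L) a i.1 i.2 * (s i.2 - z i.1) ^+ 2.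
have H0 : 0 <= H by apply: sumr_ge0 => i _; rewrite mulr_ge0 ?sqr_ge0.
have HD : H <= D.
  (* The added terms [q p - w l] average to [\sum q - \sum r = 0]; with them each summand dominates
     its Hellinger term, by [relent_term_ge]. *)
  have -> : D = \sum_p \sum_l a p l * (w l * (ln (w l) - ln (q p)) - w l + q p).
    transitivity (\sum_p \sum_l (a p l * (w l * ln (w l))) -
        \sum_p r p * ln (q p) - \sum_p r p + \sum_p q p).
      rewrite qs subrK; congr (_ - _); rewrite exchange_big /=.
      by apply: eq_bigr => l _; rewrite -mulr_suml a2 mul1r.
    rewrite -!sumrB -big_split /=; apply: eq_bigr => p _.
    rewrite mixture_addr//; congr (_ + _); rewrite rE mulr_suml -!sumrB.
    by apply: eq_bigr => l _; ring.
  rewrite pair_big /=; apply: ler_sum => -[p l] _ /=.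
  move: (q0 p); rewrite le_eqVlt => /predU1P[qp|qp].
    have : a p l * w l = 0.
      move: (qr _ (esym qp)); rewrite rE => /psumr_eq0P -> // j _.
      by rewrite mulr_ge0.
    move=> /eqP; rewrite mulf_eq0 => /orP[/eqP->|/eqP w1]; first by rewrite !mul0r.
    by rewrite /s /z w1 -qp sqrtr0 subrr expr0n /= mul0r addr0 subrr.
  rewrite ler_wpM2l//; have := relent_term_ge (w0 l) qp.
  by rewrite -/(s l) -/(z p); lra.
split; first exact: le_trans HD.
have -> : \sum_p (r p - q p) * phi p =
    \sum_(i : P * L) a i.1 i.2 * ((s i.2 - z i.1) * ((s i.2 + z i.1) * phi i.1)).
  rewrite -(pair_big xpredT xpredT (fun p l =>
    a p l * ((s l - z p) * ((s l + z p) * phi p)))) /=.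
  apply: eq_bigr => p _; rewrite rE -mixture_addr// mulr_suml.
  apply: eq_bigr => l _.
  by rewrite -s2 -z2; ring.
apply: le_trans (weighted_cauchy_schwarz _ _ (fun i => a0 i.1 i.2)) _.
rewrite -/H; set M := \sum_i _.
have MD : M <= 2 * \sum_p (r p + q p) * phi p ^+ 2.
  rewrite /M -(pair_big xpredT xpredT (fun p l =>
    a p l * ((s l + z p) * phi p) ^+ 2)) /= mulr_sumr.
  apply: ler_sum => p _; rewrite rE -mixture_addr// mulr_suml mulr_sumr.
  apply: ler_sum => l _.
  rewrite -s2 -z2 -subr_ge0.
  have -> : 2 * (a p l * (s l ^+ 2 + z p ^+ 2) * phi p ^+ 2) -
    a p l * ((s l + z p) * phi p) ^+ 2 = a p l * ((s l - z p) * phi p) ^+ 2 by ring.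
  by rewrite mulr_ge0 ?sqr_ge0.
have M0 : 0 <= M by apply: sumr_ge0 => i _; rewrite mulr_ge0 ?sqr_ge0.
rewrite -mulrA mulrCA.
apply: le_trans (ler_wpM2r M0 HD) _.
by rewrite ler_wpM2l// (le_trans H0).
Qed.

(** Let [n = #|I|] and [u = ln (n * q i)]. If [u >= 0], then [u <= ln n] because [q i <= 1]. If
    [u < 0], then [q i = expR u / n] and [expR_quartic_upper] bounds the term by [8 / n]; these
    contributions sum to at most 8. *)
Lemma ln_quartic_moment_le (I : finType) (q : I -> R) :
  (0 < #|I|)%N -> (forall i, 0 <= q i <= 1) -> \sum_i q i = 1 ->
  \sum_i q i * (ln (q i) + ln #|I|%:R) ^+ 4 <= ln #|I|%:R ^+ 4 + 8.
Proof.
move=> I0 q01 qs; set n := #|I|%:R : R.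
have n0 : 0 < n by rewrite ltr0n.
have -> : ln n ^+ 4 + 8 = \sum_i (q i * ln n ^+ 4 + 8 / n).
  by rewrite big_split /= -mulr_suml qs mul1r sumr_const
    -[_ *+ #|_|]mulr_natr divfK ?gt_eqF.
apply: ler_sum => i _; have /andP[] := q01 i.
have n8 : 0 <= 8 / n by rewrite divr_ge0 ?ltW.
rewrite le_eqVlt => /predU1P[<- _|q0 q1]; first by rewrite !mul0r add0r.
have b0 := ln_le0 q1.
have [u0|u0] := leP 0 (ln (q i) + ln n).
  rewrite -[X in X <= _]addr0; apply: lerD => //; rewrite ler_wpM2l ?(ltW q0)//.
  by apply: lerXn2r; rewrite ?nnegrE; lra.
set s := ln (q i) + ln n in u0 *.
have := @expR_quartic_upper _ (- s) _; rewrite expRN expRD !lnK ?posrE// => h.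
have {h} : (- s) ^+ 4 <= 8 / (q i * n) by apply: h; lra.
rewrite invfM mulrCA -ler_pdivrMl ?invr_gt0// invrK => h.
have -> : s ^+ 4 = (- s) ^+ 4 by ring.
by apply: le_trans h _; rewrite lerDr mulr_ge0 ?(ltW q0)// exprn_even_ge0.
Qed.


(** * Entropy and variance of product distributions *)

Definition shannon (I : finType) (q : I -> R) : R := - \sum_i q i * ln (q i).

Definition surprisal_variance (I : finType) (q : I -> R) : R :=
  \sum_i q i * ln (q i) ^+ 2 - shannon q ^+ 2.

Lemma shannon_ge0 (I : finType) (q : I -> R) :
  (forall i, 0 <= q i <= 1) -> 0 <= shannon q.
Proof.
move=> q01; rewrite oppr_ge0; apply: sumr_le0 => i _.
by have /andP[q0 q1] := q01 i; rewrite mulr_ge0_le0// ln_le0.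
Qed.

Lemma prob_le1 (I : finType) (q : I -> R) :
  (forall i, 0 <= q i) -> \sum_i q i = 1 -> forall i, 0 <= q i <= 1.
Proof.
move=> q0 qs i; rewrite q0 /= -qs (bigD1 i)//= lerDl.
by apply: sumr_ge0.
Qed.

(** Under a product distribution [- ln] is a sum of independent variables, so means and variances
    add, and a second moment is the variance plus the squared mean. Null weights are treated apart,
    since [ln 0 = 0] breaks additivity there. *)
Lemma product_entropy_moment (I J : finType) (p : I -> R) (q : J -> R) :
  (forall i, 0 <= p i) -> (forall j, 0 <= q j) ->
  \sum_i p i = 1 -> \sum_j q j = 1 ->
  \sum_(k : I * J) p k.1 * q k.2 * (1 - ln (p k.1 * q k.2)) ^+ 2 =
  surprisal_variance p + surprisal_variance q + (shannon p + shannon q + 1) ^+ 2.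
Proof.
move=> p0 q0 ps qs.
pose Hp := \sum_i p i * ln (p i); pose Hq := \sum_j q j * ln (q j).
pose Vp := \sum_i p i * ln (p i) ^+ 2; pose Vq := \sum_j q j * ln (q j) ^+ 2.
transitivity (\sum_i \sum_j (p i * (1 - ln (p i)) ^+ 2 * q j -
    2 * (p i * (1 - ln (p i))) * (q j * ln (q j)) + p i * (q j * ln (q j) ^+ 2))).
  rewrite pair_big /=; apply: eq_bigr => -[i j] _ /=.
  move: (p0 i); rewrite le_eqVlt => /predU1P[<-|pi0]; first by rewrite !mul0r; ring.
  move: (q0 j); rewrite le_eqVlt => /predU1P[<-|qj0]; first by rewrite !mulr0; ring.
  by rewrite lnM ?posrE//; ring.
transitivity (\sum_i (p i * (1 - ln (p i)) ^+ 2 -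
    2 * Hq * (p i * (1 - ln (p i))) + Vq * p i)).
  apply: eq_bigr => i _; rewrite big_split sumrB /= -!mulr_sumr qs -/Hq -/Vq.
  by ring.
transitivity (\sum_i ((1 - 2 * Hq + Vq) * p i + (2 * Hq - 2) * (p i * ln (p i)) +
    p i * ln (p i) ^+ 2)).
  by apply: eq_bigr => i _; ring.
rewrite !big_split /= -!mulr_sumr ps -/Hp -/Vp.
by rewrite /surprisal_variance /shannon -/Hp -/Hq -/Vp -/Vq; ring.
Qed.

(** The classical core of the theorem: the quantum data enter only through [B], [a] and the
    marginals of [r]. The error [X] is controlled through its square, as Cauchy-Schwarz provides
    it. *)
Lemma product_entropy_moment_le (I J K L : finType)
    (B : I * J -> K -> R) (a : I * J -> L -> R)
    (q1 : I -> R) (q2 : J -> R) (r : I * J -> R) (t : K -> R) (w : L -> R) :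
  let D := \sum_l w l * ln (w l) - \sum_k r k * ln (q1 k.1 * q2 k.2) in
  doubly_stochastic B -> doubly_stochastic a ->
  (forall k, 0 <= t k) -> \sum_k t k = 1 ->
  (forall l, 0 <= w l) -> \sum_l w l = 1 ->
  (forall k, r k = \sum_l B k l * t l) -> (forall k, r k = \sum_l a k l * w l) ->
  (forall i, \sum_j r (i, j) = q1 i) -> (forall j, \sum_i r (i, j) = q2 j) ->
  0 <= D /\
  exists2 X, X ^+ 2 <= 8 * (ln #|I|%:R ^+ 4 + ln #|J|%:R ^+ 4 + 16) * D &
    \sum_k t k * (1 - ln (t k)) ^+ 2 <=
    surprisal_variance q1 + surprisal_variance q2 +
    (shannon q1 + shannon q2 + 1) ^+ 2 + X.
Proof.
move=> D dB da t0 ts w0 ws rB ra r1 r2.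
have r0 k : 0 <= r k.
  by rewrite rB; apply: sumr_ge0 => l _; rewrite mulr_ge0//; case: dB.
have rs : \sum_k r k = 1.
  under eq_bigr => k _ do rewrite rB.
  rewrite exchange_big -[RHS]ts; apply: eq_bigr => l _ /=.
  by rewrite -mulr_suml; case: dB => _ _ ->; rewrite mul1r.
have q10 i : 0 <= q1 i by rewrite -r1; apply: sumr_ge0.
have q20 j : 0 <= q2 j by rewrite -r2; apply: sumr_ge0.
have sum2 (F : I * J -> R) : \sum_k F k = \sum_i \sum_j F (i, j).
  by rewrite pair_bigA /=; apply: eq_bigr => -[].
have q1s : \sum_i q1 i = 1.
  by rewrite -rs sum2; apply: eq_bigr => i _; rewrite r1.
have q2s : \sum_j q2 j = 1.
  by rewrite -rs sum2 exchange_big; apply: eq_bigr => i _; rewrite r2.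
pose q (k : I * J) := q1 k.1 * q2 k.2.
have mr1 f : \sum_k r k * f k.1 = \sum_i q1 i * f i.
  by rewrite sum2; apply: eq_bigr => i _ /=; rewrite -mulr_suml r1.
have mr2 f : \sum_k r k * f k.2 = \sum_j q2 j * f j.
  by rewrite sum2 exchange_big; apply: eq_bigr => i _ /=; rewrite -mulr_suml r2.
have mq1 f : \sum_k q k * f k.1 = \sum_i q1 i * f i.
  rewrite sum2; apply: eq_bigr => i _ /=; rewrite /q /=.
  by rewrite -mulr_suml -mulr_sumr q2s mulr1.
have mq2 f : \sum_k q k * f k.2 = \sum_j q2 j * f j.
  rewrite sum2 exchange_big; apply: eq_bigr => j _ /=; rewrite /q /=.
  by rewrite -mulr_suml -mulr_suml q1s mul1r.
have qs : \sum_k q k = 1.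
  transitivity (\sum_k q k * 1); first by apply: eq_bigr => k _; rewrite mulr1.
  by rewrite (mq1 (fun=> 1)) -[RHS]q1s; apply: eq_bigr => i _; rewrite mulr1.
have q0 k : 0 <= q k by rewrite mulr_ge0.
have qr k : q k = 0 -> r k = 0.
  case: k => i j /eqP; rewrite mulf_eq0 /= => /orP[] /eqP.
    by rewrite -r1 => /psumr_eq0P -> // *; exact: r0.
  by rewrite -r2 => /(psumr_eq0P (P := xpredT) (fun i _ => r0 (i, j))) ->.
have lnq k : 0 < q k -> ln (q k) = ln (q1 k.1) + ln (q2 k.2).
  move=> qk; have := q10 k.1; have := q20 k.2; rewrite !le_eqVlt.
  move=> /predU1P[h|h2] /predU1P[h'|h1];
    try by move: qk; rewrite /q -?h -?h' ?mul0r ?mulr0 ltxx.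
  by rewrite lnM.
pose cI := ln #|I|%:R : R; pose cJ := ln #|J|%:R : R.
(* The shifts centre the logarithms at the uniform distributions, as [ln_quartic_moment_le]
   requires; [phi] is the shifted cross term of [ln q ^ 2]. *)
pose u i := ln (q1 i) + cI; pose v j := ln (q2 j) + cJ.
pose phi (k : I * J) := 2 * (u k.1 * v k.2).
have qrs : \sum_k q k = \sum_k r k by rewrite qs rs.
have [D0 XD] := relent_bounds_sqr_difference phi da q0 w0 ra qr qrs.
rewrite -/D in D0 XD.
split=> //; exists (\sum_k (r k - q k) * phi k).
  apply: le_trans XD _.
  suff h : \sum_k (r k + q k) * phi k ^+ 2 <= 4 * (cI ^+ 4 + cJ ^+ 4 + 16).
    apply: le_trans (ler_wpM2l _ h) _; first by rewrite mulr_ge0.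
    by rewrite -/cI -/cJ le_eqVlt (_ : _ == _)//; apply/eqP; ring.
  (* The bound [(2 * u * v) ^ 2 <= 2 * (u ^ 4 + v ^ 4)] separates the variables. As [r] and [q]
     share their marginals, only fourth moments under [q1] and [q2] remain. *)
  apply: (@le_trans _ _ (\sum_k (r k + q k) * (2 * (u k.1 ^+ 4 + v k.2 ^+ 4)))).
    apply: ler_sum => k _; rewrite ler_wpM2l ?addr_ge0//.
    rewrite -subr_ge0 /phi.
    have -> : 2 * (u k.1 ^+ 4 + v k.2 ^+ 4) - (2 * (u k.1 * v k.2)) ^+ 2 =
      2 * (u k.1 ^+ 2 - v k.2 ^+ 2) ^+ 2 by ring.
    by rewrite mulr_ge0 ?sqr_ge0.
  have [I0 J0] : (0 < #|I|)%N /\ (0 < #|J|)%N.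
    by split; rewrite lt0n; apply/eqP => /card0_eq e0; [move: q1s|move: q2s];
      rewrite big_pred0// => /eqP; rewrite eq_sym oner_eq0.
  have hI := ln_quartic_moment_le I0 (prob_le1 q10 q1s) q1s.
  have hJ := ln_quartic_moment_le J0 (prob_le1 q20 q2s) q2s.
  have -> : \sum_k (r k + q k) * (2 * (u k.1 ^+ 4 + v k.2 ^+ 4)) =
      4 * (\sum_i q1 i * u i ^+ 4 + \sum_j q2 j * v j ^+ 4).
    transitivity (2 * (\sum_k r k * u k.1 ^+ 4 + \sum_k r k * v k.2 ^+ 4 +
        \sum_k q k * u k.1 ^+ 4 + \sum_k q k * v k.2 ^+ 4)).
      rewrite -!big_split /= mulr_sumr; apply: eq_bigr => k _; ring.
    rewrite (mr1 (fun i => u i ^+ 4)) (mr2 (fun j => v j ^+ 4)).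
    by rewrite (mq1 (fun i => u i ^+ 4)) (mq2 (fun j => v j ^+ 4)); ring.
  rewrite ler_pM2l//; apply: le_trans (lerD hI hJ) _; rewrite -/cI -/cJ.
  by rewrite le_eqVlt (_ : _ == _)//; apply/eqP; ring.
have q01 := prob_le1 q0 qs; have t01 := prob_le1 t0 ts.
apply: le_trans (mixture_entropy_moment_le dB q01 t01 rB qr qrs) _.
rewrite -product_entropy_moment// lerD2l le_eqVlt.
apply/orP; left; apply/eqP.
(* Beyond [phi], each summand depends on one index only and cancels by equality of marginals. Where
   [q k = 0] the logarithm does not split, but [r k - q k = 0]. *)
have E : \sum_k (r k - q k) * ln (q k) ^+ 2 =
    \sum_k (r k - q k) * (phi k + (ln (q1 k.1) ^+ 2 - 2 * cJ * ln (q1 k.1)) +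
    (ln (q2 k.2) ^+ 2 - 2 * cI * ln (q2 k.2) - 2 * cI * cJ)).
  apply: eq_bigr => k _.
  move: (q0 k); rewrite le_eqVlt => /predU1P[/esym e0|/lnq ->].
    by rewrite (qr _ e0) e0 subrr !mul0r.
  by rewrite /phi /u /v; ring.
rewrite E -[RHS]addr0 -[X in _ + X](subrr 0).
pose f i := ln (q1 i) ^+ 2 - 2 * cJ * ln (q1 i).
pose g j := ln (q2 j) ^+ 2 - 2 * cI * ln (q2 j) - 2 * cI * cJ.
transitivity (\sum_k (r k - q k) * phi k +
   (\sum_k r k * f k.1 - \sum_k q k * f k.1 +
   (\sum_k r k * g k.2 - \sum_k q k * g k.2))).
  by rewrite -!sumrB -!big_split /=; apply: eq_bigr => k _; rewrite /f /g; ring.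
by rewrite mr1 mr2 mq1 mq2 !subrr addr0.
Qed.

End Sums.

(** * Comparison with [kappa] and resolution of the quadratic inequality *)

(** Writing [kappa = sqrt (2 * ln 2) * c], one has [kappa * sqrt (D / ln 2) = sqrt (2 * D) * c]. So
    [4 * (x ^ 4 + y ^ 4 + 16) <= c ^ 2] suffices, because [f_corr] dominates the square root. *)
Lemma le_kappa_f_corr (R : realType) (m n : nat) (X D : R) :
  (2 <= m * n)%N -> 0 <= D ->
  X ^+ 2 <= 8 * (ln m%:R ^+ 4 + ln n%:R ^+ 4 + 16) * D ->
  X <= kappa R (m * n) * f_corr (D / ln 2).
Proof.
move=> mn D0 XD.
have [m0 n0] : (0 < m)%N /\ (0 < n)%N.
  by apply/andP; rewrite -muln_gt0; apply: leq_trans mn.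
have a_ge := @ln2_lower R; set a := ln 2 in a_ge.
have a0 : 0 < a by lra.
set x := ln m%:R in XD; set y := ln n%:R in XD.
have x0 : 0 <= x by apply: ln_ge0; rewrite ler1n.
have y0 : 0 <= y by apply: ln_ge0; rewrite ler1n.
have LE : ln (m * n)%:R = x + y by rewrite natrM lnM ?posrE ?ltr0n.
have aL : a <= x + y.
  by rewrite -LE /a ler_ln ?posrE ?ltr0n ?muln_gt0 ?m0// ler_nat.
set c := 12 * a ^+ 2 + 9 * (x + y) ^+ 2.
have c0 : 0 <= c by rewrite /c; have := sqr_ge0 a; have := sqr_ge0 (x + y); lra.
(* With [z = (x + y) ^ 2], it suffices that [4 * z ^ 2 + 64 <= (12 * (31 / 50) ^ 2 + 9 * z) ^ 2].
   The worst case is [z = (31 / 50) ^ 2], where [437 * (31 / 50) ^ 4 >= 64] holds narrowly; this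
   fixes the precision of [ln2_lower]. *)
have h : 4 * (x ^+ 4 + y ^+ 4 + 16) <= c ^+ 2.
  have h4 : x ^+ 4 + y ^+ 4 <= (x + y) ^+ 4.
    rewrite -subr_ge0.
    have -> : (x + y) ^+ 4 - (x ^+ 4 + y ^+ 4) =
      x * y * (4 * x ^+ 2 + 6 * (x * y) + 4 * y ^+ 2) by ring.
    by rewrite !(mulr_ge0, addr_ge0) ?sqr_ge0.
  have z_ge : (31 / 50) ^+ 2 <= (x + y) ^+ 2.
    by apply: lerXn2r; rewrite ?nnegrE; lra.
  have a2_ge : (31 / 50) ^+ 2 <= a ^+ 2 by apply: lerXn2r; rewrite ?nnegrE; lra.
  have : (12 * (31 / 50) ^+ 2 + 9 * (x + y) ^+ 2) ^+ 2 <= c ^+ 2.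
    by apply: lerXn2r; rewrite ?nnegrE// /c; lra.
  have -> : 4 * (x ^+ 4 + y ^+ 4 + 16) = 4 * (x ^+ 4 + y ^+ 4) + 64 by ring.
  rewrite (exprM (x + y) 2 2) in h4.
  move: (c ^+ 2) ((x + y) ^+ 2) z_ge (x ^+ 4 + y ^+ 4) h4 => C z z_ge Q h4.
  by nra.
apply: (@le_trans _ _ (kappa R (m * n) * Num.sqrt (D / a))).
  rewrite /kappa LE -/a -/c.
  have -> : Num.sqrt (2 * a) * c * Num.sqrt (D / a) = Num.sqrt (2 * D) * c.
    rewrite mulrAC -sqrtrM ?mulr_ge0 ?(ltW a0)//; congr (Num.sqrt _ * _).
    by field; rewrite gt_eqF.
  have s0 : 0 <= Num.sqrt (2 * D) * c by rewrite mulr_ge0 ?sqrtr_ge0.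
  apply: le_trans (ler_norm X) _.
  rewrite -(ler_pXn2r (isT : (0 < 2)%N)) ?nnegrE ?normr_ge0// real_normK ?num_real//.
  rewrite exprMn sqr_sqrtr ?mulr_ge0//.
  apply: le_trans XD _.
  have := ler_wpM2r D0 h; lra.
rewrite ler_wpM2l//.
  by rewrite /kappa LE -/a -/c mulr_ge0 ?sqrtr_ge0.
rewrite /f_corr div1r le_max; apply/orP; right.
by rewrite div1r powR12_sqrt// divr_ge0 ?(ltW a0).
Qed.

Lemma sqrt_increment_le (R : realType) (s s' N : R) :
  0 < s -> 0 <= s' -> s ^+ 2 + N <= s' ^+ 2 ->
  s * (Num.sqrt (1 + N / s ^+ 2) - 1) <= s' - s.
Proof.
move=> s0 s'0 h; rewrite mulrBr mulr1 lerD2r.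
(* [Num.sqrt] is 0 on nonpositive reals, so the claim becomes [0 <= s']. *)
have [neg|pos] := leP (1 + N / s ^+ 2) 0; first by rewrite ler0_sqrtr// mulr0.
rewrite -[X in _ <= X](ger0_norm s'0) -sqrtr_sqr -[X in X * _](ger0_norm (ltW s0)).
rewrite -sqrtr_sqr -sqrtrM ?sqr_ge0// ler_wsqrtr//.
by rewrite mulrDr mulr1 mulrCA divff ?mulr1// expf_eq0 /= gt_eqF.
Qed.

(** * Spectral calculus for positive semidefinite matrices *)

Section Spectral.
Variable R : realType.
Local Notation C := R[i].

(* Locked, like [real_diag_mx] below, to keep matrix products from being unified
   up to unfolding of their factors. *)
Definition adjmx m n (A : 'M[C]_(m, n)) : 'M[C]_(n, m) :=
  locked (map_mx Num.conj A^T).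

Local Notation "A ^h" := (adjmx A) (at level 2, format "A ^h").

Lemma adjmxE m n (A : 'M[C]_(m, n)) : A^h = map_mx Num.conj A^T.
Proof. by rewrite /adjmx -lock. Qed.

Lemma adjmxK m n (A : 'M[C]_(m, n)) : (A^h)^h = A.
Proof. by rewrite !adjmxE trmxCK. Qed.

Lemma adjmxM m n p (A : 'M[C]_(m, n)) (B : 'M[C]_(n, p)) :
  (A *m B)^h = B^h *m A^h.
Proof. by rewrite !adjmxE trmx_mul map_mxM. Qed.

Lemma adjmx_delta m n i j : (delta_mx i j : 'M[C]_(m, n))^h = delta_mx j i.
Proof. by rewrite adjmxE trmx_delta map_delta_mx. Qed.

Lemma psdmxE n (A : 'M[C]_n) :
  psdmx A <-> forall v : 'cV[C]_n, 0 <= (v^h *m A *m v) 0 0.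
Proof. by split=> h v; have := h v; rewrite adjmxE map_trmx. Qed.

Lemma psdmx_conj_diag m n (A : 'M[C]_n) (X : 'M[C]_(m, n)) i :
  psdmx A -> 0 <= (X *m A *m X^h) i i.
Proof.
move=> /psdmxE /(_ (X^h *m delta_mx i 0)).
rewrite adjmxM adjmxK adjmx_delta !mulmxA -colE -!mulmxA -rowE !mulmxA.
by rewrite [X in 0 <= X]mxE [X in 0 <= X]mxE.
Qed.

Definition real_diag_mx n (p : 'I_n -> R) : 'M[C]_n :=
  locked (diag_mx (\row_i (p i)%:C%C)).

Lemma real_diag_mxE n (p : 'I_n -> R) :
  real_diag_mx p = diag_mx (\row_i (p i)%:C%C).
Proof. by rewrite /real_diag_mx -lock. Qed.

Lemma mul_mx_real_diag n (p : 'I_n -> R) (M : 'M[C]_n) i j :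
  (M *m real_diag_mx p) i j = M i j * (p j)%:C%C.
Proof. by rewrite real_diag_mxE mul_mx_diag !mxE. Qed.

(** Any eigenbasis is allowed, not only the one picked by [spectralmx], so that tensor products of
    eigenbases qualify. *)
Definition diagonalizes n (V : 'M[C]_n) (p : 'I_n -> R) (A : 'M[C]_n) : Prop :=
  V \is unitarymx /\ A = V^h *m real_diag_mx p *m V.

Lemma unitary_mul_adj n (V : 'M[C]_n) : V \is unitarymx -> V *m V^h = 1%:M.
Proof. by rewrite adjmxE => /unitarymxP. Qed.

Lemma unitary_adj_mul n (V : 'M[C]_n) : V \is unitarymx -> V^h *m V = 1%:M.
Proof. by rewrite adjmxE => /unitarymxP/mulmx1C. Qed.

Lemma invmx_unitary_adj n (V : 'M[C]_n) : V \is unitarymx -> invmx V = V^h.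
Proof. by rewrite adjmxE; exact: invmx_unitary. Qed.

Lemma mulmx_unitaryK m n (V : 'M[C]_n) (M : 'M[C]_(m, n)) :
  V \is unitarymx -> M *m V *m V^h = M.
Proof. by move=> uV; rewrite -mulmxA unitary_mul_adj ?mulmx1. Qed.

Lemma mulmx_unitaryVK m n (V : 'M[C]_n) (M : 'M[C]_(m, n)) :
  V \is unitarymx -> M *m V^h *m V = M.
Proof. by move=> uV; rewrite -mulmxA unitary_adj_mul ?mulmx1. Qed.

Lemma conj_unitaryK n (V M : 'M[C]_n) :
  V \is unitarymx -> V *m (V^h *m M *m V) *m V^h = M.
Proof.
by move=> uV; rewrite !mulmxA unitary_mul_adj// mul1mx mulmx_unitaryK.
Qed.

(** The matrix [M = A - A^h] is skew-Hermitian, hence normal. Diagonal entries of [A] in any basis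
    are real, so those of [M] vanish; in an eigenbasis of [M] this makes its spectrum zero. *)
Lemma psdmx_hermitian n (A : 'M[C]_n) : psdmx A -> A^h = A.
Proof.
move=> psdA; apply/esym/eqP; rewrite -subr_eq0; apply/eqP.
set M := A - A^h.
have MN : M^h = - M.
  by rewrite /M [LHS]adjmxE linearB /= map_mxB -!adjmxE adjmxK opprB.
have Mnormal : M \is normalmx.
  by apply/normalmxP; rewrite -adjmxE MN mulmxN mulNmx.
have diag0 (X : 'M[C]_n) i : (X *m M *m X^h) i i = 0.
  have -> : X *m M *m X^h = X *m A *m X^h - (X *m A *m X^h)^h.
    by rewrite !adjmxM adjmxK mulmxA /M mulmxBr mulmxBl.
  move: (_ *m _ *m _) (psdmx_conj_diag X i psdA) => Y h.
  by rewrite adjmxE !mxE (CrealP (ger0_real h)) subrr.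
have /orthomx_spectralP := Mnormal.
have := spectral_unitarymx M; set S := spectralmx M; set z := spectral_diag M.
move=> uS; rewrite invmx_unitary_adj// => ME.
have z0 : z = 0.
  apply/rowP => i; rewrite mxE -(diag0 S i) ME conj_unitaryK//.
  by rewrite mxE eqxx mulr1n.
by rewrite ME z0 raddf0 mulmx0 mul0mx.
Qed.

Lemma psdmx_diagonalizes n (A : 'M[C]_n) : psdmx A ->
  exists V, exists2 p, diagonalizes V p A & forall i, 0 <= p i.
Proof.
move=> psdA.
have /orthomx_spectralP : A \is normalmx.
  by apply/normalmxP; rewrite -adjmxE psdmx_hermitian.
have := spectral_unitarymx A; set S := spectralmx A; set z := spectral_diag A.
move=> uS; rewrite invmx_unitary_adj// => AE.
have d0 i : 0 <= z 0 i.
  have := psdmx_conj_diag S i psdA; rewrite AE conj_unitaryK//.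
  by rewrite mxE eqxx mulr1n.
exists S, (fun i => complex.Re (z 0 i)); last first.
  by move=> i; have := d0 i; rewrite lecE => /andP[].
split; first exact: uS.
rewrite real_diag_mxE [LHS]AE (_ : \row_i _ = z) //.
by apply/rowP => i; rewrite mxE RRe_real// ger0_real.
Qed.

Lemma diagonalizes_diag n (V : 'M[C]_n) p A :
  diagonalizes V p A -> V *m A *m V^h = real_diag_mx p.
Proof. by move=> [uV AE]; rewrite AE (conj_unitaryK _ uV). Qed.

Lemma diagonalizes_psdmx n (V : 'M[C]_n) p A :
  diagonalizes V p A -> (forall i, 0 <= p i) -> psdmx A.
Proof.
move=> [_ AE] p0; apply/psdmxE => v; rewrite AE.
have -> : v^h *m (V^h *m real_diag_mx p *m V) *m v =
    (V *m v)^h *m real_diag_mx p *m (V *m v) by rewrite adjmxM !mulmxA.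
set w := V *m v; rewrite real_diag_mxE mul_mx_diag mxE.
apply: sumr_ge0 => i _.
by rewrite adjmxE !mxE mulrAC mulr_ge0 ?ler0c// mulrC mul_conjC_ge0.
Qed.

(* The change of basis between two eigenbases only links equal eigenvalues, so
   it intertwines any function of the two spectra. *)
Lemma mxln_diagonalizes n (V : 'M[C]_n) p A :
  diagonalizes V p A -> diagonalizes V (fun i => ln (p i)) (mxln A).
Proof.
move=> [uV AE]; split; first exact: uV.
have : A \is normalmx.
  apply/orthomx_spectral_subproof; exists (V, \row_i (p i)%:C%C); first exact: uV.
  by rewrite (invmx_unitary_adj uV) AE real_diag_mxE.
move=> /orthomx_spectralP; rewrite /mxln.
have := spectral_unitarymx A; set S := spectralmx A; set z := spectral_diag A.
move=> uS; rewrite (invmx_unitary_adj uS); set f := map_mx _ z.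
move=> ASE; pose W := S *m V^h.
have SW : S = W *m V by rewrite /W mulmx_unitaryVK.
have VW : S^h *m W = V^h by rewrite /W mulmxA unitary_adj_mul// mul1mx.
have WP : W *m real_diag_mx p = diag_mx z *m W.
  transitivity (S *m A *m V^h).
    by rewrite AE /W !mulmxA (mulmx_unitaryK _ uV).
  by rewrite ASE /W !mulmxA (unitary_mul_adj uS) mul1mx.
clearbody W; have Wf : diag_mx f *m W = W *m real_diag_mx (fun i => ln (p i)).
  apply/matrixP => i j.
  have := congr1 (fun M : 'M[C]_n => M i j) WP.
  rewrite !mul_mx_real_diag !mul_diag_mx.
  rewrite [X in _ = X -> _]mxE [X in _ -> X = _]mxE [f _ _]mxE mulrC => /eqP.
  rewrite -subr_eq0 -mulrBl mulf_eq0 subr_eq0 => /orP[/eqP<-|/eqP->] /=.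
    by rewrite mulrC.
  by rewrite mulr0 mul0r.
have -> : S^h *m diag_mx f *m S = S^h *m (diag_mx f *m W) *m V.
  by rewrite {2}SW !mulmxA.
by rewrite Wf mulmxA VW.
Qed.

Lemma diagonalizes_mul n (V : 'M[C]_n) p q A B :
  diagonalizes V p A -> diagonalizes V q B ->
  diagonalizes V (fun i => p i * q i) (A *m B).
Proof.
move=> [uV AE] [_ BE]; split; first exact: uV.
rewrite AE BE !mulmxA (mulmx_unitaryK _ uV).
have <- : real_diag_mx p *m real_diag_mx q = real_diag_mx (fun i => p i * q i).
  rewrite !real_diag_mxE mulmx_diag; congr diag_mx.
  by apply/rowP => i; rewrite !mxE rmorphM.
by rewrite !mulmxA.
Qed.

Lemma trace_mul_diagonalizes n (V : 'M[C]_n) p A M :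
  diagonalizes V p A -> \tr (M *m A) = \sum_i (V *m M *m V^h) i i * (p i)%:C%C.
Proof.
move=> [_ AE]; rewrite AE mulmxA mxtrace_mulC !mulmxA /mxtrace.
by apply: eq_bigr => i _; rewrite mul_mx_real_diag.
Qed.

Lemma trace_diagonalizes n (V : 'M[C]_n) p A :
  diagonalizes V p A -> \tr A = (\sum_i p i)%:C%C.
Proof.
move=> dA; rewrite -[A]mul1mx (trace_mul_diagonalizes _ dA) rmorph_sum.
apply: eq_bigr => i _; case: dA => uV _.
by rewrite mulmx1 unitary_mul_adj// mxE eqxx mul1r.
Qed.

Lemma entropy_diagonalizes n (V : 'M[C]_n) p A :
  diagonalizes V p A -> entropy A = shannon p.
Proof.
move=> dA; rewrite /entropy.
by rewrite (trace_diagonalizes (diagonalizes_mul dA (mxln_diagonalizes dA))).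
Qed.

Lemma entropy_variance_diagonalizes n (V : 'M[C]_n) p A :
  diagonalizes V p A -> entropy_variance A = surprisal_variance p.
Proof.
move=> dA; rewrite /entropy_variance (entropy_diagonalizes dA).
have dl := mxln_diagonalizes dA.
by rewrite (trace_diagonalizes (diagonalizes_mul dA (diagonalizes_mul dl dl))).
Qed.

(** The cross term [\tr (rho *m mxln sigma)] sees only the diagonal of [rho] in an eigenbasis of
    [sigma]. *)
Lemma relative_entropy_diagonalizes n (V W : 'M[C]_n) q w sigma rho :
  diagonalizes W w rho -> diagonalizes V q sigma ->
  relative_entropy rho sigma = \sum_i w i * ln (w i) -
    \sum_i complex.Re ((V *m rho *m V^h) i i) * ln (q i).
Proof.
move=> dr ds; rewrite /relative_entropy.
have := trace_diagonalizes (diagonalizes_mul dr (mxln_diagonalizes dr)).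
have := trace_mul_diagonalizes rho (mxln_diagonalizes ds).
move: (mxln rho) (mxln sigma) => A B trB trA.
rewrite mulmxBr linearB /= trA trB raddfB /=.
congr (_ - _); rewrite raddf_sum; apply: eq_bigr => i _.
by case: ((V *m rho *m V^h) i i) => x y /=; rewrite mulr0 subr0.
Qed.

Lemma tensmx11 m n : (1%:M : 'M[C]_m) *t (1%:M : 'M[C]_n) = 1%:M.
Proof.
apply/matrixP => i j; case: (mxtens_indexP i) => i1 i2.
case: (mxtens_indexP j) => j1 j2; rewrite tensmxE !mxE.
by rewrite (can_eq (@mxtens_indexK _ _)) xpair_eqE -natrM mulnb.
Qed.

Lemma adjmx_tens m n p q (A : 'M[C]_(m, n)) (B : 'M[C]_(p, q)) :
  (A *t B)^h = A^h *t B^h.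
Proof. by rewrite !adjmxE trmx_tens map_mxT. Qed.

Lemma diagonalizes_tens m n (V : 'M[C]_m) (W : 'M[C]_n) p q A B :
  diagonalizes V p A -> diagonalizes W q B ->
  diagonalizes (V *t W)
    (fun k => p (mxtens_unindex k).1 * q (mxtens_unindex k).2) (A *t B).
Proof.
move=> [uV AE] [uW BE].
split.
  apply/unitarymxP; rewrite -adjmxE adjmx_tens tensmx_mul.
  by rewrite !unitary_mul_adj// tensmx11.
rewrite adjmx_tens AE BE -!tensmx_mul.
have -> // : real_diag_mx p *t real_diag_mx q =
  real_diag_mx (fun k => p (mxtens_unindex k).1 * q (mxtens_unindex k).2).
apply/matrixP => i j; case: (mxtens_indexP i) => i1 i2.
case: (mxtens_indexP j) => j1 j2.
rewrite tensmxE !real_diag_mxE !mxE !mxtens_indexK /=.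
rewrite (can_eq (@mxtens_indexK _ _)) xpair_eqE rmorphM.
by do 2!case: eqP => _ /=; rewrite ?mulr1n ?mulr0n ?mulr0 ?mul0r.
Qed.

End Spectral.

(** * Transition matrices of positive maps, and partial traces *)

Section Maps.
Variable R : realType.
Local Notation C := R[i].
Local Notation "A ^h" := (adjmx A) (at level 2, format "A ^h").

Definition eigenproj n (W : 'M[C]_n) (k : 'I_n) : 'M[C]_n :=
  W^h *m real_diag_mx (fun i => (i == k)%:R) *m W.

Lemma diagonalizes_eigenproj n (W : 'M[C]_n) k :
  W \is unitarymx -> diagonalizes W (fun i => (i == k)%:R) (eigenproj W k).
Proof. by []. Qed.

Lemma diagonalizes1 n (W : 'M[C]_n) :
  W \is unitarymx -> diagonalizes W (fun=> 1) 1%:M.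
Proof.
move=> uW; split; first exact: uW.
rewrite (_ : real_diag_mx _ = 1%:M) ?mulmx1 ?unitary_adj_mul//.
by rewrite real_diag_mxE; apply/matrixP => i j; rewrite !mxE.
Qed.

Lemma spectral_decomposition n (W : 'M[C]_n) t A :
  diagonalizes W t A -> A = \sum_k (t k)%:C%C *: eigenproj W k.
Proof.
move=> [uW ->].
have -> : real_diag_mx t =
    \sum_k (t k)%:C%C *: real_diag_mx (fun i => (i == k)%:R : R).
  apply/matrixP => i j; rewrite summxE (bigD1 i)//= big1 ?addr0 => [|k /negPf ki].
    by rewrite !real_diag_mxE !mxE eqxx mulrnAr mulr1.
  by rewrite !real_diag_mxE !mxE eq_sym ki mul0rn mulr0.
rewrite mulmx_sumr mulmx_suml; apply: eq_bigr => k _.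
by rewrite -scalemxAr -scalemxAl.
Qed.

(** For a channel [Phi], the probability of outcome [j] in the basis [V] after [Phi] acts on the
    [k]-th state of the basis [W]. *)
Definition transition n (Phi : 'M[C]_n -> 'M[C]_n) (V W : 'M[C]_n)
  (j k : 'I_n) : R := complex.Re ((V *m Phi (eigenproj W k) *m V^h) j j).

Lemma transition_mixture n (Phi : {linear 'M[C]_n -> 'M[C]_n}) (V W : 'M[C]_n)
    t A j :
  diagonalizes W t A ->
  complex.Re ((V *m Phi A *m V^h) j j) = \sum_k transition Phi V W j k * t k.
Proof.
move=> /spectral_decomposition ->; rewrite linear_sum mulmx_sumr mulmx_suml.
rewrite summxE raddf_sum; apply: eq_bigr => k _.
rewrite linearZ -scalemxAr -scalemxAl mxE /transition.
by case: ((_ *m _) j j) => x y /=; rewrite mul0r subr0 mulrC.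
Qed.

(** Positivity gives nonnegative entries, unitality the row sums and trace preservation the column
    sums. *)
Lemma transition_doubly_stochastic n (Phi : {linear 'M[C]_n -> 'M[C]_n})
    (V W : 'M[C]_n) :
  V \is unitarymx -> W \is unitarymx ->
  (forall A, psdmx A -> psdmx (Phi A)) -> (forall A, \tr (Phi A) = \tr A) ->
  Phi 1%:M = 1%:M ->
  doubly_stochastic (transition Phi V W).
Proof.
move=> uV uW posPhi trPhi Phi1; split=> [j k|j|k].
- have psdP : psdmx (eigenproj W k).
    by apply: (diagonalizes_psdmx (diagonalizes_eigenproj k uW)) => i; case: eqP.
  by have := psdmx_conj_diag V j (posPhi _ psdP); rewrite lecE => /andP[].
- transitivity (\sum_k transition Phi V W j k * 1).
    by apply: eq_bigr => k _; rewrite mulr1.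
  rewrite -(transition_mixture Phi V j (diagonalizes1 uW)) Phi1 mulmx1.
  by rewrite unitary_mul_adj// mxE eqxx.
- rewrite -raddf_sum -/(mxtrace _) mxtrace_mulC mulmxA unitary_adj_mul// mul1mx.
  rewrite trPhi (trace_diagonalizes (diagonalizes_eigenproj k uW)) /=.
  by rewrite (bigD1 k)//= eqxx big1 ?addr0// => i /negPf->.
Qed.

Lemma trace_mul_psdmx_ge0 n (A B : 'M[C]_n) :
  psdmx A -> psdmx B -> 0 <= \tr (A *m B).
Proof.
move=> psdA /psdmx_diagonalizes[V [p dB p0]].
rewrite (trace_mul_diagonalizes _ dB); apply: sumr_ge0 => i _.
by rewrite mulr_ge0 ?ler0c// psdmx_conj_diag.
Qed.

Lemma psdmx1 n : psdmx (1%:M : 'M[C]_n).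
Proof.
have u1 : (1%:M : 'M[C]_n) \is unitarymx.
  by apply/unitarymxP; rewrite trmx1 map_mx1 mulmx1.
by apply: (diagonalizes_psdmx (diagonalizes1 u1)) => i; exact: ler01.
Qed.

Lemma psdmx_tens m n (A : 'M[C]_m) (B : 'M[C]_n) :
  psdmx A -> psdmx B -> psdmx (A *t B).
Proof.
move=> /psdmx_diagonalizes[V [p dA p0]] /psdmx_diagonalizes[W [q dB q0]].
by apply: (diagonalizes_psdmx (diagonalizes_tens dA dB)) => k; rewrite mulr_ge0.
Qed.

(** Testing against the rank-one matrices [v *m v^h] recovers the quadratic form. With
    [trace_mul_psdmx_ge0] this is self-duality of the positive cone. *)
Lemma psdmx_of_trace n (A : 'M[C]_n) :
  (forall B, psdmx B -> 0 <= \tr (A *m B)) -> psdmx A.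
Proof.
move=> h; apply/psdmxE => v.
rewrite -trace_mx11 -mulmxA mxtrace_mulC -mulmxA; apply: h.
apply/psdmxE => x.
have -> : x^h *m (v *m v^h) *m x = (v^h *m x)^h *m (v^h *m x).
  by rewrite adjmxM adjmxK !mulmxA.
by rewrite mxE big_ord1 adjmxE !mxE mulrC mul_conjC_ge0.
Qed.

Lemma sum_mxtens_index (T : nmodType) m n (F : 'I_(m * n) -> T) :
  \sum_k F k = \sum_i \sum_j F (mxtens_index (i, j)).
Proof.
rewrite pair_bigA (reindex (@mxtens_index m n)) /=.
  by apply: eq_bigr => -[].
by exists (@mxtens_unindex m n) => k _; rewrite ?mxtens_indexK ?mxtens_unindexK.
Qed.

(** Adjointness of the partial trace and [X *t 1%:M]; positivity, trace and diagonal marginals of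
    reduced states are all derived from it. *)
Lemma trace_ptrace_r_mul m n (A : 'M[C]_(m * n)) (X : 'M[C]_m) :
  \tr (ptrace_r A *m X) = \tr (A *m (X *t 1%:M)).
Proof.
rewrite /mxtrace [RHS]sum_mxtens_index; apply: eq_bigr => i _.
rewrite mxE [RHS](eq_bigr (fun k =>
    \sum_j A (mxtens_index (i, k)) (mxtens_index (j, k)) * X j i)).
  rewrite exchange_big; apply: eq_bigr => j _ /=.
  by rewrite mxE mulr_suml.
move=> k _; rewrite mxE sum_mxtens_index; apply: eq_bigr => j _.
rewrite (bigD1 k)//= big1 ?addr0 => [|l /negPf lk]; rewrite tensmxE mxE.
  by rewrite eqxx mulr1.
by rewrite lk !mulr0.
Qed.

Lemma trace_ptrace_l_mul m n (A : 'M[C]_(m * n)) (X : 'M[C]_n) :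
  \tr (ptrace_l A *m X) = \tr (A *m (1%:M *t X)).
Proof.
rewrite /mxtrace [RHS]sum_mxtens_index exchange_big; apply: eq_bigr => k _ /=.
rewrite mxE [RHS](eq_bigr (fun i =>
    \sum_l A (mxtens_index (i, k)) (mxtens_index (i, l)) * X l k)).
  rewrite exchange_big; apply: eq_bigr => l _ /=.
  by rewrite mxE mulr_suml.
move=> i _; rewrite mxE sum_mxtens_index (bigD1 i)//=.
rewrite [X in _ + X]big1 ?addr0 => [|j /negPf ji].
  by apply: eq_bigr => l _; rewrite tensmxE mxE eqxx mul1r.
by apply: big1 => l _; rewrite tensmxE mxE ji mul0r mulr0.
Qed.

Lemma psdmx_ptrace_r m n (A : 'M[C]_(m * n)) : psdmx A -> psdmx (ptrace_r A).
Proof.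
move=> psdA; apply: psdmx_of_trace => B psdB; rewrite trace_ptrace_r_mul.
by apply: (trace_mul_psdmx_ge0 psdA); apply: (psdmx_tens psdB); exact: psdmx1.
Qed.

Lemma psdmx_ptrace_l m n (A : 'M[C]_(m * n)) : psdmx A -> psdmx (ptrace_l A).
Proof.
move=> psdA; apply: psdmx_of_trace => B psdB; rewrite trace_ptrace_l_mul.
by apply: (trace_mul_psdmx_ge0 psdA); apply: (psdmx_tens _ psdB); exact: psdmx1.
Qed.

Lemma trace_mul_eigenproj n (V : 'M[C]_n) M i :
  V \is unitarymx -> \tr (M *m eigenproj V i) = (V *m M *m V^h) i i.
Proof.
move=> uV; rewrite (trace_mul_diagonalizes _ (diagonalizes_eigenproj i uV)).
rewrite (bigD1 i)//= eqxx mulr1 big1 ?addr0// => j /negPf->.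
by rewrite mulr0.
Qed.

(** Both sides are the trace of [A] against [eigenproj V i *t 1%:M], which is diagonal in the
    product basis. This supplies the marginals of [r]. *)
Lemma ptrace_r_conj_diag m n (A : 'M[C]_(m * n)) (V : 'M[C]_m) (W : 'M[C]_n) i :
  V \is unitarymx -> W \is unitarymx ->
  \sum_j ((V *t W) *m A *m (V *t W)^h) (mxtens_index (i, j)) (mxtens_index (i, j)) =
  (V *m ptrace_r A *m V^h) i i.
Proof.
move=> uV uW; rewrite -trace_mul_eigenproj// trace_ptrace_r_mul.
have d := diagonalizes_tens (diagonalizes_eigenproj i uV) (diagonalizes1 uW).
rewrite (trace_mul_diagonalizes _ d) sum_mxtens_index (bigD1 i)//.
rewrite [X in _ = _ + X]big1 ?addr0 => [|k /negPf ki].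
  by apply: eq_bigr => j _; rewrite mxtens_indexK /= eqxx mulr1 mulr1.
by apply: big1 => j _; rewrite mxtens_indexK /= ki mul0r mulr0.
Qed.

Lemma ptrace_l_conj_diag m n (A : 'M[C]_(m * n)) (V : 'M[C]_m) (W : 'M[C]_n) j :
  V \is unitarymx -> W \is unitarymx ->
  \sum_i ((V *t W) *m A *m (V *t W)^h) (mxtens_index (i, j)) (mxtens_index (i, j)) =
  (W *m ptrace_l A *m W^h) j j.
Proof.
move=> uV uW; rewrite -trace_mul_eigenproj// trace_ptrace_l_mul.
have d := diagonalizes_tens (diagonalizes1 uV) (diagonalizes_eigenproj j uW).
rewrite (trace_mul_diagonalizes _ d) sum_mxtens_index exchange_big (bigD1 j)//.
rewrite [X in _ = _ + X]big1 ?addr0 => [|k /negPf kj].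
  by apply: eq_bigr => i _; rewrite mxtens_indexK /= eqxx mulr1 mulr1.
by apply: big1 => i _; rewrite mxtens_indexK /= kj mulr0 mulr0.
Qed.

Lemma psdmx_castmx n n' (e : n = n') (A : 'M[C]_n) :
  psdmx A -> psdmx (castmx (e, e) A).
Proof. by case: n' / e; rewrite castmx_id. Qed.

(** The ampliation with [k = 1] is [Phi] itself, up to identifying the sizes [1 * n] and [n]. *)
Lemma completely_positive_psdmx m n (Phi : 'M[C]_n -> 'M[C]_m) A :
  completely_positive Phi -> psdmx A -> psdmx (Phi A).
Proof.
move=> cp psdA.
have := psdmx_castmx (mul1n m) (cp 1%N _ (psdmx_castmx (esym (mul1n n)) psdA)).
congr (psdmx _); apply/matrixP => i j; rewrite castmxE mxE.
have mxE1 k (c : 'I_k) a :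
    cast_ord (esym (esym (mul1n k))) (mxtens_index (a, c)) = c.
  by apply: val_inj; rewrite /= (ord1 a) mul0n add0n.
have unE k (c : 'I_k) : mxtens_unindex (cast_ord (esym (mul1n k)) c) = (ord0, c).
  by apply: (can_inj (@mxtens_indexK _ _)); rewrite mxtens_unindexK; apply: val_inj.
rewrite !unE; congr (Phi _ i j); apply/matrixP => c d.
by rewrite mxE castmxE !mxE1.
Qed.

End Maps.

(** * Spectra of states and reindexing by pairs *)

Lemma state_diagonalizes (R : realType) n (rho : 'M[R[i]]_n) : state rho ->
  exists V, exists2 p, diagonalizes V p rho &
    (forall i, 0 <= p i) /\ \sum_i p i = 1.
Proof.
move=> [/psdmx_diagonalizes[V [p dV p0]] tr1]; exists V, p => //; split=> //.
apply: (@complexI R); rewrite -(trace_diagonalizes dV).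
exact: tr1.
Qed.

Lemma state_ptrace_r (R : realType) m n (rho : 'M[R[i]]_(m * n)) :
  state rho -> state (ptrace_r rho).
Proof.
move=> [psd tr1]; split; first exact: psdmx_ptrace_r.
by rewrite -[ptrace_r _]mulmx1 trace_ptrace_r_mul tensmx11 mulmx1.
Qed.

Lemma state_ptrace_l (R : realType) m n (rho : 'M[R[i]]_(m * n)) :
  state rho -> state (ptrace_l rho).
Proof.
move=> [psd tr1]; split; first exact: psdmx_ptrace_l.
by rewrite -[ptrace_l _]mulmx1 trace_ptrace_l_mul tensmx11 mulmx1.
Qed.

Lemma doubly_stochastic_reindex (R : realType) (P Q K : finType) (h : P -> Q)
    (B : Q -> K -> R) :
  bijective h -> doubly_stochastic B ->
  doubly_stochastic (fun p k => B (h p) k).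
Proof.
move=> bh [B0 B1 B2]; split=> // k; rewrite -(B2 k) [RHS](reindex h)//.
exact: onW_bij.
Qed.

Lemma mxtens_index_bij m n : bijective (@mxtens_index m n).
Proof.
by exists (@mxtens_unindex m n); [exact: mxtens_indexK|exact: mxtens_unindexK].
Qed.

(** * Reduction of the quantum statement to the classical inequality *)

Unset Implicit Arguments.
Set Strict Implicit.
Set Printing Implicit Defensive.

Theorem mainTheorem14 (R : realType) (dS dE : nat) (hd : (2 <= dS * dE)%N)
    (rhoS : 'M[R[i]]_dS) (rhoE : 'M[R[i]]_dE)
    (hS : state rhoS) (hE : state rhoE)
    (U : {linear 'M[R[i]]_(dS * dE) -> 'M[R[i]]_(dS * dE)})
    (hU : channel U) (hU1 : unital U) :
  let rhoSE' := U (tensmx rhoS rhoE) in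
  let rhoS' := ptrace_r rhoSE' in
  let rhoE' := ptrace_l rhoSE' in
  let DSS := entropy rhoS' - entropy rhoS in
  let DSE := entropy rhoE' - entropy rhoE in
  let DCS := entropy_variance rhoS' - entropy_variance rhoS in
  let DCE := entropy_variance rhoE' - entropy_variance rhoE in
  let I := mutual_information rhoSE' in
  let s := entropy rhoS + entropy rhoE + 1 in
  DSS + DSE >=
    s * (Num.sqrt (1 + (- DCS - DCE - kappa R (dS * dE) * f_corr (I / ln 2))
                         / s ^+ 2) - 1).
Proof.
cbv zeta; set rhoSE' := U _; set rhoS' := ptrace_r rhoSE'.
set rhoE' := ptrace_l rhoSE'; set I := mutual_information rhoSE'.
case: hU => cpU trU.
have [psdS trS] := hS; have [psdE trE] := hE.
have [VS [pS dS_ [pS0 pS1]]] := state_diagonalizes hS.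
have [VE [pE dE_ [pE0 pE1]]] := state_diagonalizes hE.
have dSE := diagonalizes_tens dS_ dE_.
have hSE' : state rhoSE'.
  split; first exact: completely_positive_psdmx cpU (psdmx_tens psdS psdE).
  rewrite trU (trace_diagonalizes dSE) sum_mxtens_index.
  rewrite -[RHS](rmorph1 (real_complex R)) -pS1; congr (_%:C)%C.
  apply: eq_bigr => i _; rewrite -[RHS]mulr1 -pE1 mulr_sumr.
  by apply: eq_bigr => j _; rewrite mxtens_indexK.
have [W [w dW [w0 w1]]] := state_diagonalizes hSE'.
have [VS' [qS dS' [qS0 qS1]]] := state_diagonalizes (state_ptrace_r hSE').
have [VE' [qE dE' [qE0 qE1]]] := state_diagonalizes (state_ptrace_l hSE').
have dSE' := diagonalizes_tens dS' dE'.
have IE : I = relative_entropy rhoSE' (tensmx rhoS' rhoE') by [].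
rewrite (relative_entropy_diagonalizes dW dSE') in IE.
have [uSE _] := dSE; have [uW _] := dW; have [uSE' _] := dSE'.
have [uS' _] := dS'; have [uE' _] := dE'.
set V' := VS' *t VE' in uSE' IE.
pose h := @mxtens_index dS dE.
have bh : bijective h by exact: mxtens_index_bij.
pose r k : R := complex.Re ((V' *m rhoSE' *m adjmx V') (h k) (h k)).
pose B k l := transition U V' (VS *t VE) (h k) l.
(* Taking the identity channel makes [a] the matrix of squared overlaps between the product
   eigenbasis and the eigenbasis [W] of [rhoSE']. *)
pose idm : {linear 'M[R[i]]_(dS * dE) -> 'M[R[i]]_(dS * dE)} := idfun.
pose a k l := transition idm V' W (h k) l.
have dB : doubly_stochastic B.
  apply: (doubly_stochastic_reindex bh).
  apply: (transition_doubly_stochastic uSE' uSE _ trU hU1) => A.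
  exact: completely_positive_psdmx cpU.
have da : doubly_stochastic a.
  apply: (doubly_stochastic_reindex bh).
  exact: (@transition_doubly_stochastic _ _ idm _ _ uSE' uW
    (fun A psdA => psdA) (fun A => erefl) erefl).
have rB k : r k = \sum_l B k l * (pS (mxtens_unindex l).1 * pE (mxtens_unindex l).2).
  exact: transition_mixture dSE.
have ra k : r k = \sum_l a k l * w l.
  exact: (transition_mixture idm V' (h k) dW).
have r1 i : \sum_j r (i, j) = qS i.
  rewrite -raddf_sum (ptrace_r_conj_diag _ _ uS' uE') (diagonalizes_diag dS').
  by rewrite real_diag_mxE !mxE eqxx.
have r2 j : \sum_i r (i, j) = qE j.
  rewrite -raddf_sum (ptrace_l_conj_diag _ _ uS' uE') (diagonalizes_diag dE').
  by rewrite real_diag_mxE !mxE eqxx.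
pose t l := pS (mxtens_unindex l).1 * pE (mxtens_unindex l).2.
have t0 l : 0 <= t l by rewrite mulr_ge0.
have sum_t (F : R -> R) :
    \sum_l F (t l) = \sum_(k : 'I_dS * 'I_dE) F (pS k.1 * pE k.2).
  rewrite sum_mxtens_index pair_bigA; apply: eq_bigr => k _.
  by rewrite /t mxtens_indexK.
have t1 : \sum_l t l = 1.
  rewrite (sum_t id) -(pair_bigA _ (fun i j => pS i * pE j)) /= -[RHS]pS1.
  by apply: eq_bigr => i _; rewrite -mulr_sumr pE1 mulr1.
have [D0 [X XD le]] := product_entropy_moment_le dB da t0 t1 w0 w1 rB ra r1 r2.
have ID : I = \sum_l w l * ln (w l) - \sum_k r k * ln (qS k.1 * qE k.2).
  rewrite IE; congr (_ - _); rewrite sum_mxtens_index pair_bigA.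
  by apply: eq_bigr => -[i j] _; rewrite mxtens_indexK.
rewrite -ID !card_ord in D0 XD.
have XK := le_kappa_f_corr hd D0 XD.
rewrite (sum_t (fun x => x * (1 - ln x) ^+ 2)) product_entropy_moment// in le.
rewrite (entropy_diagonalizes dS_) (entropy_diagonalizes dE_).
rewrite (entropy_diagonalizes dS') (entropy_diagonalizes dE').
rewrite (entropy_variance_diagonalizes dS_) (entropy_variance_diagonalizes dE_).
rewrite (entropy_variance_diagonalizes dS') (entropy_variance_diagonalizes dE').
have HS := shannon_ge0 (prob_le1 pS0 pS1).
have HE := shannon_ge0 (prob_le1 pE0 pE1).
have HS' := shannon_ge0 (prob_le1 qS0 qS1).
have HE' := shannon_ge0 (prob_le1 qE0 qE1).
set K := kappa R _ * _ in XK *.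
clear - HS HE HS' HE' le XK.
(* Together [le] and [XK] say [s ^ 2 + N <= s' ^ 2], where [s'] is the final value of [s] and [N]
   the numerator; [s' - s] is the total entropy change. *)
apply: (@le_trans _ _ ((shannon qS + shannon qE + 1) -
    (shannon pS + shannon pE + 1))).
  by apply: sqrt_increment_le; lra.
by lra.
Qed.
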